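(* Let $\alpha\in[0,1)$ and $\beta=1-\alpha$. Let $\Psi_1,\Psi_2:\mathbb{R}^N\to\mathbb{R}$ and $F:\Gamma\to\mathbb{R}$ be bounded Borel functions such that $\Psi_1\le\Psi_2$ in $X$ and $\Psi_1\le F\le\Psi_2$ in $\Gamma$. Then, for every $0<\epsilon<\bar\epsilon_0$, there exists a unique Borel function $u_\epsilon:X\to\mathbb{R}$ which satisfies $$u_\epsilon(x)=\begin{cases}\max\Big\{\Psi_1(x),\ \min\Big\{\Psi_2(x),\ \dfrac{\alpha}{2}\sup_{B_\epsilon(x)}u_\epsilon+\dfrac{\alpha}{2}\inf_{B_\epsilon(x)}u_\epsilon+\dfrac{\beta}{|B_\epsilon(x)|}\displaystyle\int_{B_\epsilon(x)}u_\epsilon\Big\}\Big\} & \text{for } x\in\Omega,\\[2mm] F(x) & \text{for } x\in\Gamma.\end{cases}$$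
   Context: $\Omega\subset\mathbb{R}^N$ is an open, bounded domain with Lipschitz boundary. $\bar\epsilon_0$ with $0<\bar\epsilon_0\ll1$ is a fixed small constant, and $$\Gamma=\{x\in\mathbb{R}^N\setminus\Omega:\ \mathrm{dist}(x,\Omega)<\bar\epsilon_0\},\qquad X=\Gamma\cup\Omega.$$ $B_\epsilon(x)$ is the open ball of radius $\epsilon$ centered at $x$, and $|B_\epsilon(x)|$ is its Lebesgue measure. For $x\in\Omega$ and $\epsilon<\bar\epsilon_0$ one has $B_\epsilon(x)\subset X$. *)

(* Defs.v *)
From HB Require Import structures.
From mathcomp Require Import all_boot all_order all_algebra.
From mathcomp Require Import all_classical all_reals all_analysis.
Set Implicit Arguments.
Unset Strict Implicit.
Unset Printing Implicit Defensive.
Import Order.TTheory GRing.Theory Num.Theory.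
Import numFieldTopology.Exports numFieldNormedType.Exports.
Local Open Scope classical_set_scope.
Local Open Scope ring_scope.

(* Borel sigma-algebra of 'M[R]_(m, n), in particular of R^N := 'rV[R]_N *)
HB.instance Definition _ (R : realType) (m n : nat) :=
  @isMeasurable.Build (sigma_display (@open 'M[R]_(m, n))) 'M[R]_(m, n)
    <<s @open 'M[R]_(m, n) >> (@sigma_algebra0 _ setT _) (@sigma_algebraC _ _)
    (@sigma_algebra_bigcup _ setT _).

(* The product measure of m1 and m2, carried to tuples along (x, t) |-> x :: t. *)
Section product_measure_cons.
Context d (T : measurableType d) (R : realType) (n : nat).
Variable m1 : {sigma_finite_measure set T -> \bar R}.
Variable m2 : {sigma_finite_measure set (n.-tuple T) -> \bar R}.

Definition tuple_cons (p : T * n.-tuple T) : n.+1.-tuple T :=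
  [tuple of p.1 :: p.2].

Let measurable_tuple_cons : measurable_fun setT tuple_cons.
Proof. exact: measurable_cons. Qed.

HB.instance Definition _ := isMeasurableFun.Build _ _ _ _ tuple_cons
  measurable_tuple_cons.

Definition product_measure_cons : set (n.+1.-tuple T) -> \bar R :=
  pushforward (m1 \x m2)%E tuple_cons.

Let product_measure_cons0 : product_measure_cons set0 = 0%E.
Proof. exact: measure0. Qed.

Let product_measure_cons_ge0 A : (0 <= product_measure_cons A)%E.
Proof. exact: measure_ge0. Qed.

Let product_measure_cons_sigma_additive :
  semi_sigma_additive product_measure_cons.
Proof. exact: measure_semi_sigma_additive. Qed.

HB.instance Definition _ := isMeasure.Build _ _ _ product_measure_cons
  product_measure_cons0 product_measure_cons_ge0
  product_measure_cons_sigma_additive.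

Let sigma_finite_product_measure_cons : sigma_finite setT product_measure_cons.
Proof.
have /sigma_finiteP[F [FT ndF Foo]] := sigma_finiteT m1.
have /sigma_finiteP[G [GT ndG Goo]] := sigma_finiteT m2.
pose g (t : n.+1.-tuple T) : T * n.-tuple T := (thead t, [tuple of behead t]).
have mg : measurable_fun setT g.
  apply/measurable_fun_pairP; split => /=; first exact: measurable_tnth.
  exact: measurable_behead.
have gK p : g (tuple_cons p) = p.
  by case: p => x t; congr pair; exact/val_inj.
exists (fun i => g @^-1` (F i `*` G i)).
  rewrite -preimage_bigcup -[LHS](preimage_setT g); congr (_ @^-1` _).
  apply/seteqP; split=> // -[x t] _.
  have [i _ Fix] : (\bigcup_i F i) x by rewrite -FT.
  have [j _ Gjt] : (\bigcup_i G i) t by rewrite -GT.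
  exists (maxn i j) => //; split => /=.
  - by move: x Fix; exact/subsetPset/ndF/leq_maxl.
  - by move: t Gjt; exact/subsetPset/ndG/leq_maxr.
move=> i; have [mFi Fioo] := Foo i; have [mGi Gioo] := Goo i; split.
  by rewrite -[X in measurable X]setTI; apply: mg => //; exact: measurableX.
rewrite /product_measure_cons /pushforward -comp_preimage.
rewrite (_ : _ \o _ = id); last exact/funext.
rewrite preimage_id product_measure1E//.
by rewrite lte_mul_pinfty// ge0_fin_numE.
Qed.

HB.instance Definition _ := Measure_isSigmaFinite.Build _ _ _
  product_measure_cons sigma_finite_product_measure_cons.

End product_measure_cons.

Section lebesgue_measure_rV.
Context {R : realType}.
Local Notation RT := (measurableTypeR R).

Fixpoint lebesgue_measure_tuple (n : nat) :
    {sigma_finite_measure set (n.-tuple RT) -> \bar R} :=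
  match n with
  | 0 => \d_ ([tuple] : 0.-tuple RT)
  | m.+1 => product_measure_cons (@lebesgue_measure R) (lebesgue_measure_tuple m)
  end.

Context {N : nat}.

Definition row_of_tuple (t : N.-tuple RT) : 'rV[R]_N := \row_i tnth t i.

(* An open set is a countable union of cubes with rational centers. *)
Let measurable_row_of_tuple : measurable_fun setT row_of_tuple.
Proof.
apply: (@measurability _ _ _ _ _ _ (@open 'rV[R]_N)) => //.
move=> _ [U oU <-]; rewrite setTI.
pose B (i : 'rV[rat]_N * nat) : set 'rV[R]_N :=
  @ball R 'rV[R]_N (map_mx (ratr : rat -> R) i.1) i.2.+1%:R^-1.
pose G i : set (N.-tuple RT) :=
  if `[< B i `<=` U >] then row_of_tuple @^-1` B i else set0.
rewrite (_ : _ @^-1` _ = \bigcup_i G i); last first.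
  apply/seteqP; split=> [t Ut|t [i _]]; last first.
    by rewrite /G; case: asboolP => // BU; exact: BU.
  move: oU; rewrite openE => /(_ _ Ut) /nbhs_ballP[e /= e0 eU].
  pose k := Num.truncn (2 / e).
  have ke : k.+1%:R^-1 < e / 2.
    by rewrite invf_plt ?posrE ?divr_gt0// invf_div truncnS_gt.
  have k0 : 0 < k.+1%:R^-1 :> R by rewrite invr_gt0.
  have /choice[q qt] (i : 'I_N) : exists q : rat,
      `|ratr q - tnth t i| < k.+1%:R^-1.
    have /rat_in_itvoo[q] : tnth t i - k.+1%:R^-1 < tnth t i + k.+1%:R^-1.
      by rewrite ltrD2l gtrN.
    by rewrite in_itv/= => qt; exists q; rewrite ltr_distl.
  exists (\row_i q i, k) => //; rewrite /G; case: asboolP => [_|].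
    by split => // i j; rewrite !mxE; exact: qt.
  case=> y [_ Bqy]; apply: eU; split => // i j; move: (Bqy i j).
  rewrite !mxE /ball/= => qy; rewrite -(subrKA (ratr (q j))).
  rewrite (le_lt_trans (ler_normD _ _))// distrC [ltRHS]splitr ltrD//.
    exact: lt_trans (qt j) ke.
  exact: lt_trans qy ke.
apply: countable_bigcupT_measurable => // i; rewrite /G.
case: ifP => // _.
rewrite (_ : _ @^-1` _ = \bigcap_(j in [set: 'I_N])
    (@tnth N RT ^~ j) @^-1` ball (ratr (i.1 0 j) : R) i.2.+1%:R^-1).
  apply: fin_bigcap_measurable => // j _.
  rewrite -[X in measurable X]setTI; apply: measurable_tnth => //.
  rewrite ball_itv; exact: measurable_itv.
apply/seteqP; split => [t [_ Bt] j _|t Bt].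
  by have := Bt 0 j; rewrite !mxE.
by split => // a j; rewrite !mxE; move: (Bt j I); rewrite (ord1 a).
Qed.

HB.instance Definition _ := isMeasurableFun.Build _ _ _ _ row_of_tuple
  measurable_row_of_tuple.

Definition lebesgue_measure_rV : set 'rV[R]_N -> \bar R :=
  pushforward (lebesgue_measure_tuple N) row_of_tuple.

Let lebesgue_measure_rV0 : lebesgue_measure_rV set0 = 0%E.
Proof. exact: measure0. Qed.

Let lebesgue_measure_rV_ge0 A : (0 <= lebesgue_measure_rV A)%E.
Proof. exact: measure_ge0. Qed.

Let lebesgue_measure_rV_sigma_additive :
  semi_sigma_additive lebesgue_measure_rV.
Proof. exact: measure_semi_sigma_additive. Qed.

HB.instance Definition _ := isMeasure.Build _ _ _ lebesgue_measure_rV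
  lebesgue_measure_rV0 lebesgue_measure_rV_ge0
  lebesgue_measure_rV_sigma_additive.

End lebesgue_measure_rV.

Lemma lebesgue_measure_tuple_box (R : realType) n (A : 'I_n -> set (measurableTypeR R)) :
  (forall i, measurable (A i)) ->
  lebesgue_measure_tuple n [set t | forall i, A i (tnth t i)] =
  (\prod_i lebesgue_measure (A i))%E.
Proof.
elim: n A => [|n IH] A mA.
  by rewrite big_ord0 /= diracE mem_set//= => -[].
rewrite big_ord_recl -IH//.
rewrite -[LHS]/((lebesgue_measure \x lebesgue_measure_tuple n)%E _) -product_measure1E//; last first.
  rewrite (_ : [set _ | _] = \bigcap_(j in [set: 'I_n])
    (@tnth n (measurableTypeR R) ^~ j) @^-1` A (lift ord0 j)).
    apply: fin_bigcap_measurable => // j _.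
    by rewrite -[X in measurable X]setTI; apply: measurable_tnth.
  by apply/seteqP; split => [t At j _|t At j]; exact: At.
congr (product_measure1 _ _ _); apply/seteqP; split => [[x t]/= At|[x t]/= [Ax At] i].
  split; first exact: (At ord0).
  by move=> i; have := At (lift ord0 i); rewrite tnthS.
by case: (unliftP ord0 i) => [j|] ->; rewrite ?tnthS//; exact: At.
Qed.

Lemma lebesgue_measure_rV_box (R : realType) n (A : 'I_n -> set (measurableTypeR R)) :
  (forall i, measurable (A i)) ->
  lebesgue_measure_rV [set x : 'rV[R]_n | forall i, A i (x 0 i)] =
  (\prod_i lebesgue_measure (A i))%E.
Proof.
move=> mA; rewrite -lebesgue_measure_tuple_box// /lebesgue_measure_rV /pushforward.
by congr (lebesgue_measure_tuple _ _); apply/seteqP; split => t /= At i; have := At i; rewrite mxE.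
Qed.

Section euclidean.
Context {R : realType} {N : nat}.
Implicit Types (x p : 'rV[R]_N) (A Omega : set 'rV[R]_N).

(* The library norm `|x| on 'rV[R]_N is the sup norm. *)
Definition enorm x : R := Num.sqrt (\sum_i x 0 i ^+ 2).

Definition eball x (r : R) : set 'rV[R]_N := [set y | enorm (y - x) < r].

Definition dist_set x A : R := inf [set enorm (x - y) | y in A].

Definition domain Omega : Prop :=
  [/\ Omega !=set0, open Omega & connected Omega].

End euclidean.

(* Near each boundary point, and after an orthogonal change of coordinates Q,
   Omega is the set of points lying above the graph of a Lipschitz function phi
   of the N - 1 coordinates other than the i-th one. *)
Definition lipschitz_boundary {R : realType} {N : nat}
    (Omega : set 'rV[R]_N) : Prop :=
  forall p, (closure Omega `\` Omega°) p ->
  exists (r : R) (Q : 'M[R]_N) (i : 'I_N) (phi : 'rV[R]_N.-1 -> R) (k : R),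
    [/\ 0 < r, Q *m Q^T = 1%:M,
        forall a b, `|phi a - phi b| <= k * enorm (a - b) &
        forall x, eball p r x ->
          (Omega x <-> phi (col' i (x *m Q)) < (x *m Q) 0 i)].

Section double_obstacle.
Context {R : realType} {N : nat}.
Variables (Omega : set 'rV[R]_N) (eps0 : R).

Definition Gamma : set 'rV[R]_N :=
  [set x | ~ Omega x /\ dist_set x Omega < eps0].

Definition Xdom : set 'rV[R]_N := Gamma `|` Omega.

Variables (alpha beta : R) (Psi1 Psi2 F : 'rV[R]_N -> R) (eps : R).

(* A function Xdom -> R is represented by a total function of which only the
   values on Xdom matter. *)
Definition borel_solution (u : 'rV[R]_N -> R) : Prop :=
  [/\ measurable_fun Xdom u,
      forall x, Omega x ->
        u x = Num.max (Psi1 x) (Num.min (Psi2 x)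
          (alpha / 2 * sup (u @` eball x eps) +
           alpha / 2 * inf (u @` eball x eps) +
           beta / fine (lebesgue_measure_rV (eball x eps)) *
             \int[lebesgue_measure_rV]_(y in eball x eps) u y)) &
      forall x, Gamma x -> u x = F x].

End double_obstacle.

(* Main.v *)
Require Import Defs.
From HB Require Import structures.
From mathcomp Require Import all_boot all_order all_algebra.
From mathcomp Require Import all_classical all_reals all_analysis.
From mathcomp Require Import measurable_realfun ring lra.
Set Implicit Arguments.
Unset Strict Implicit.
Unset Printing Implicit Defensive.
Import Order.TTheory GRing.Theory Num.Theory.
Import numFieldTopology.Exports numFieldNormedType.Exports.
Local Open Scope classical_set_scope.
Local Open Scope ring_scope.

(** The right-hand side of the equation, extended by [F] on Gamma, defines an
    operator [T] on bounded functions, and the Borel solutions are exactly its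
    fixed points among the Borel functions that are bounded on X and equal to [F]
    on Gamma ([borel_solutionP]). Existence and uniqueness come from Banach's
    fixed point argument, applied to a power of [T].

    Suprema, infima, means and truncations between obstacles are all
    1-Lipschitz for the sup norm and [alpha + beta = 1], so [T] does not increase
    sup distances, but in general it does not decrease them either. It gains where
    two functions [u] and [v] with [`|u - v| <= M] are closer than [M] on a fixed
    proportion of the ball around [x]: the mean value term has weight
    [beta > 0], and it feels this gain ([tug_mean_le], [obstacle_op_dist]). Two
    competitors agree on Gamma, hence agree at every point of X to the right of
    Omega in the direction of a fixed coordinate axis. Every ball contains a cube
    that lies entirely to the right of its centre, by at least a fixed step, and
    that fills a fixed proportion of the ball. So each application of [T]
    propagates the gain one step to the left ([obstacle_op_iter_halfspace]). Since Omega
    is bounded, finitely many steps cover it, and some power of [T] is a strict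
    contraction on all of X ([obstacle_op_iter_contraction]). The iterates of [T]
    then converge uniformly to a fixed point, and it is the only one
    ([eventual_contraction_fixpoint]).

    That [T] preserves Borel functions is due to the balls being open: a point of
    [eball x r] stays in it under small changes of [x], so both the supremum over
    [eball x r] of an arbitrary function and the integral over [eball x r] of a
    nonnegative function are lower semicontinuous in [x]
    ([measurable_fun_sup_eball], [measurable_fun_ge0_integral_eball]). *)

(** * The Euclidean norm *)

Section euclidean_norm.
Context {R : realType} {N : nat}.
Implicit Types x y z : 'rV[R]_N.

Lemma enorm_ge0 x : 0 <= enorm x.
Proof. exact: sqrtr_ge0. Qed.

Lemma enorm_sqr x : enorm x ^+ 2 = \sum_i x 0 i ^+ 2.
Proof. by rewrite sqr_sqrtr// sumr_ge0// => i _; exact: sqr_ge0. Qed.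

Lemma enormN x : enorm (- x) = enorm x.
Proof. by rewrite /enorm; under eq_bigr do rewrite mxE sqrrN. Qed.

Lemma enormC x y : enorm (x - y) = enorm (y - x).
Proof. by rewrite -enormN opprB. Qed.

Lemma enorm0 : enorm (0 : 'rV[R]_N) = 0.
Proof. by rewrite /enorm big1 ?sqrtr0// => i _; rewrite mxE expr0n. Qed.

Lemma coord_le_enorm x i : `|x 0 i| <= enorm x.
Proof.
rewrite -ler_sqr ?nnegrE ?enorm_ge0// enorm_sqr real_normK ?num_real//.
by rewrite (bigD1 i)//= lerDl sumr_ge0// => j _; exact: sqr_ge0.
Qed.

Lemma cauchy_schwarz_enorm x y : \sum_i x 0 i * y 0 i <= enorm x * enorm y.
Proof.
have [x0|x0] := eqVneq (enorm x) 0.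
  rewrite x0 mul0r big1// => i _.
  have := coord_le_enorm x i; rewrite x0 normr_le0 => /eqP ->.
  by rewrite mul0r.
have [y0|y0] := eqVneq (enorm y) 0.
  rewrite y0 mulr0 big1// => i _.
  have := coord_le_enorm y i; rewrite y0 normr_le0 => /eqP ->.
  by rewrite mulr0.
have xy0 : 0 < enorm x * enorm y by rewrite mulr_gt0// lt0r ?x0 ?y0 enorm_ge0.
have : 0 <= \sum_i (x 0 i * enorm y - y 0 i * enorm x) ^+ 2.
  by apply: sumr_ge0 => i _; exact: sqr_ge0.
have sqrE i : (x 0 i * enorm y - y 0 i * enorm x) ^+ 2 =
    enorm y ^+ 2 * x 0 i ^+ 2 + enorm x ^+ 2 * y 0 i ^+ 2
    - (2 * (enorm x * enorm y)) * (x 0 i * y 0 i) by ring.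
under eq_bigr do rewrite sqrE.
rewrite big_split/= sumrN big_split/= -!mulr_sumr -!enorm_sqr.
rewrite (_ : _ - _ = 2 * (enorm x * enorm y) *
  (enorm x * enorm y - \sum_i x 0 i * y 0 i)); last by ring.
by rewrite pmulr_rge0 ?subr_ge0// mulr_gt0.
Qed.

Lemma ler_enormD x y : enorm (x + y) <= enorm x + enorm y.
Proof.
rewrite -ler_sqr ?nnegrE ?addr_ge0 ?enorm_ge0// sqrrD !enorm_sqr.
under eq_bigr => i _ do rewrite mxE sqrrD.
rewrite !big_split/= lerD2r lerD2l.
by rewrite mulr2n lerD ?cauchy_schwarz_enorm.
Qed.

(** Compares the Euclidean norm with the sup norm that defines the topology of
    ['rV[R]_N]. The factor [N.+1], larger than the optimal [Num.sqrt N], makes the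
    inequality strict in every dimension. *)
Lemma enorm_lt_box x h : 0 < h -> (forall i, `|x 0 i| <= h) ->
  enorm x < N.+1%:R * h.
Proof.
move=> h0 xh; rewrite -ltr_sqr ?nnegrE ?enorm_ge0 ?mulr_ge0// ?(ltW h0)//.
rewrite enorm_sqr (@le_lt_trans _ _ (N%:R * h ^+ 2))//.
  rewrite (_ : N%:R * h ^+ 2 = \sum_(i < N) h ^+ 2); last first.
    by rewrite sumr_const card_ord mulr_natl.
  apply: ler_sum => i _; rewrite -real_normK ?num_real//.
  by rewrite ler_sqr ?nnegrE ?(ltW h0).
rewrite exprMn ltr_pM2r ?exprn_gt0// -natrX ltr_nat.
by rewrite (@leq_trans N.+1)// -[X in (X <= _)%N]expn1 leq_pexp2l.
Qed.

Lemma eball_shrink x y r s : enorm (x - y) <= s -> eball x (r - s) `<=` eball y r.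
Proof.
move=> xys z; rewrite /eball/= => zx.
rewrite -(subrKA x) (le_lt_trans (ler_enormD _ _))//.
by rewrite -(subrK s r) ltr_leD.
Qed.

Lemma open_eball x r : open (eball x r).
Proof.
rewrite openE => y xy; apply/nbhs_ballP.
have d0 : 0 < (r - enorm (y - x)) / N.+1%:R by rewrite divr_gt0// subr_gt0.
exists ((r - enorm (y - x)) / N.+1%:R) => //= z [_ yz].
apply: (@eball_shrink y x _ (enorm (y - x))) => //.
rewrite /eball/= -[ltRHS](@mulfVK _ N.+1%:R)// mulrC enorm_lt_box// => i.
by have := yz 0 i; rewrite /ball/= !mxE distrC => /ltW.
Qed.

End euclidean_norm.

(** * Balls and cubes *)

(** The quotient of the volume [(h / 2) ^ N] of [corner_box x r], where
    [h = r / N.+1], by the volume [(2 r) ^ N] of a cube containing the ball. *)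
Definition box_ratio (R : realType) (N : nat) : R := (4 * N.+1%:R) ^- N.

Section balls_and_boxes.
Context {R : realType} {N : nat}.
Implicit Types x y z : 'rV[R]_N.
Local Notation mu := (@lebesgue_measure_rV R N).

Definition box x (a b : R) : set 'rV[R]_N :=
  [set y | forall i, x 0 i + a < y 0 i < x 0 i + b].

Lemma open_measurable_rV (A : set 'rV[R]_N) : open A -> measurable A.
Proof. exact: sub_sigma_algebra. Qed.

Lemma measurable_eball x r : measurable (eball x r).
Proof. by apply: open_measurable_rV; apply: open_eball. Qed.

Lemma measurable_box x a b : measurable (box x a b).
Proof.
rewrite (_ : box x a b = \bigcap_(i in [set: 'I_N])
   ((fun y : 'rV[R]_N => y 0 i) @^-1` `]x 0 i + a, x 0 i + b[%classic)); last first.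
  apply/seteqP; split => y /= xy i; first by move=> _; rewrite /= in_itv/= xy.
  by have := xy i I; rewrite /= in_itv.
apply: fin_bigcap_measurable => // i _; apply: open_measurable_rV.
apply: open_comp; last exact: itv_open.
by move=> y _; exact: coord_continuous.
Qed.

Lemma lebesgue_measure_box x a b : a <= b -> mu (box x a b) = ((b - a) ^+ N)%:E.
Proof.
move=> ab.
pose A i : set (measurableTypeR R) := `]x 0 i + a, x 0 i + b[%classic.
rewrite (_ : box x a b = [set y | forall i, A i (y 0 i)]); last first.
  by apply/seteqP; split => y xy i; have := xy i; rewrite /A/= in_itv/=.
rewrite (@lebesgue_measure_rV_box _ _ A); last by move=> i; exact: measurable_itv.
under eq_bigr => i _.
  rewrite lebesgue_measure_itv/= lte_fin ltrD2l.
  rewrite (_ : (if _ then _ else _) = (b - a)%:E); last first.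
    case: ltP => [_|ba]; first by rewrite -EFinB opprD addrACA subrr add0r.
    by rewrite (@le_anti _ _ a b) ?ab// subrr.
  over.
by rewrite prodEFin prodr_const card_ord.
Qed.

(** A cube in the ball [eball x r] all of whose points lie to the right of [x], by
    a margin independent of [x], along every coordinate axis. *)
Definition corner_box x r := box x (r / N.+1%:R / 2) (r / N.+1%:R).

Lemma corner_box_sub_eball x r : 0 < r -> corner_box x r `<=` eball x r.
Proof.
move=> r0 y xy; have h0 : 0 < r / N.+1%:R by rewrite divr_gt0.
rewrite /eball/= -[ltRHS](@mulfVK _ N.+1%:R)// mulrC enorm_lt_box// => i.
move: (xy i); rewrite !mxE => /andP[y1 y2].
set h := r / _ in h0 y1 y2 *.
rewrite ler_norml; apply/andP; split; lra.
Qed.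

Lemma eball_sub_box x r : eball x r `<=` box x (- r) r.
Proof.
move=> y xy i; have := le_lt_trans (coord_le_enorm (y - x) i) xy.
by rewrite !mxE ltr_distl.
Qed.

Lemma lebesgue_measure_eball_ub x r : 0 <= r ->
  (mu (eball x r) <= ((2 * r) ^+ N)%:E)%E.
Proof.
move=> r0; rewrite (_ : 2 * r = r - - r); last by rewrite opprK mulr_natl mulr2n.
rewrite -(@lebesgue_measure_box x) ?ge0_cp//.
by apply: le_measure; rewrite ?inE//; [exact: measurable_eball|
  exact: measurable_box|exact: eball_sub_box].
Qed.

Lemma lebesgue_measure_eball_fin x r : 0 <= r -> mu (eball x r) \is a fin_num.
Proof.
move=> r0; rewrite ge0_fin_numE ?measure_ge0//.
by rewrite (le_lt_trans (lebesgue_measure_eball_ub _ _))// ltry.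
Qed.

Lemma lebesgue_measure_eball_gt0 x r : 0 < r -> 0 < fine (mu (eball x r)).
Proof.
move=> r0; have h0 : 0 < r / N.+1%:R by rewrite divr_gt0.
rewrite fine_gt0// -ge0_fin_numE ?lebesgue_measure_eball_fin ?(ltW r0)// andbT.
rewrite (@lt_le_trans _ _ (mu (corner_box x r)))//.
  rewrite /corner_box; set h := r / _ in h0 *.
  rewrite lebesgue_measure_box; last by lra.
  by rewrite lte_fin exprn_gt0//; lra.
by apply: le_measure; rewrite ?inE//; [exact: measurable_box|
  exact: measurable_eball|exact: corner_box_sub_eball].
Qed.

Lemma box_ratio_gt0 : 0 < box_ratio R N.
Proof. by rewrite invr_gt0 exprn_gt0. Qed.

Lemma box_ratio_le1 : box_ratio R N <= 1.
Proof.
rewrite invf_le1 ?exprn_gt0// exprn_ege1// -natrM ler1n//.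
Qed.

Lemma box_ratioP x r : 0 < r ->
  box_ratio R N * fine (mu (eball x r)) <=
  fine (mu (corner_box x r)).
Proof.
move=> r0; have h0 : 0 < r / N.+1%:R by rewrite divr_gt0.
rewrite /corner_box lebesgue_measure_box/=; last first.
  by set h := r / _ in h0 *; lra.
rewrite [X in _ <= X ^+ _](_ : _ = r / N.+1%:R / 2); last first.
  by set h := r / _ in h0 *; lra.
rewrite (_ : r / N.+1%:R / 2 = (4 * N.+1%:R)^-1 * (2 * r)); last first.
  by field; rewrite nat1r pnatr_eq0.
rewrite exprMn exprVn -/(box_ratio R N) ler_wpM2l ?(ltW box_ratio_gt0)//.
rewrite -lee_fin fineK ?lebesgue_measure_eball_fin ?(ltW r0)//.
by rewrite lebesgue_measure_eball_ub// ltW.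
Qed.

End balls_and_boxes.

(** * Measurability of suprema and integrals over moving balls *)

Section measurability.
Context {R : realType} {N : nat}.
Implicit Types (D X : set 'rV[R]_N) (u : 'rV[R]_N -> R).
Local Notation mu := (@lebesgue_measure_rV R N).

Lemma lsc_measurable_fun D u : measurable D ->
  (forall c, open (D `&` [set x | c < u x])) -> measurable_fun D u.
Proof.
move=> mD lu _; apply: (measurability _ (RGenOInfty.measurableE R)) => //.
move=> /= _ [_ [c ->] <-]; rewrite preimage_itvoy.
exact: open_measurable_rV.
Qed.

Lemma lsc_measurable_fun_fine D (G : 'rV[R]_N -> \bar R) : measurable D ->
  (forall x, D x -> G x \is a fin_num) ->
  (forall c : R, open (D `&` [set x | (c%:E < G x)%E])) ->
  measurable_fun D (fine \o G).
Proof.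
move=> mD Gfin lG; apply: lsc_measurable_fun => // c.
rewrite (_ : _ `&` _ = D `&` [set x | (c%:E < G x)%E])//.
by apply/seteqP; split => x [Dx] /=; rewrite -lte_fin fineK ?Gfin.
Qed.

(** The function [u] is arbitrary: the supremum exceeds [c] exactly on the union of
    the open balls centred at the points where [u] exceeds [c]. *)
Lemma measurable_fun_sup_eball D u r : open D -> 0 < r ->
  (forall x, D x -> has_ubound (u @` eball x r)) ->
  measurable_fun D (fun x => sup (u @` eball x r)).
Proof.
move=> oD r0 ub; apply: lsc_measurable_fun; first exact: open_measurable_rV.
move=> c.
rewrite (_ : _ `&` _ = D `&` \bigcup_(y in [set y | c < u y]) eball y r).
  by apply: openI => //; apply: bigcup_open => y _; exact: open_eball.
apply/seteqP; split => x [Dx] /=.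
  move=> /sup_gt[|_ [y xy <-] cy].
    by exists (u x), x => //; rewrite /eball/= subrr enorm0.
  by split => //; exists y => //; rewrite /eball/= enormC.
case=> y /= cy xy; split => //=; apply: (lt_le_trans cy).
by apply: ub_le_sup; [exact: ub|exists y => //; rewrite /eball/= enormC].
Qed.

Lemma measurable_fun_inf_eball D u r : open D -> 0 < r ->
  (forall x, D x -> has_lbound (u @` eball x r)) ->
  measurable_fun D (fun x => inf (u @` eball x r)).
Proof.
move=> oD r0 lb.
rewrite (_ : (fun x => _) = -%R \o (fun x => sup ((-%R \o u) @` eball x r))).
  apply: measurableT_comp; first exact: oppr_measurable.
  apply: measurable_fun_sup_eball => // x /lb[l ul].
  by exists (- l) => _ [y xy <-] /=; rewrite lerN2; apply: ul; exists y.
by apply/funext => x; rewrite /inf/= image_comp.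
Qed.

Lemma bounded_le (A : set 'rV[R]_N) u C : (forall x, A x -> `|u x| <= C) ->
  [bounded u x | x in A].
Proof.
by move=> uC; exists C; split; [exact: num_real|move=> M /ltW CM x Ax;
  exact: (le_trans (uC _ Ax))].
Qed.

Lemma integrable_eball X u C x r : 0 <= r -> measurable X -> measurable_fun X u ->
  (forall y, X y -> `|u y| <= C) -> eball x r `<=` X ->
  mu.-integrable (eball x r) (EFin \o u).
Proof.
move=> r0 mX mu_ uC xX; apply: measurable_bounded_integrable.
- exact: measurable_eball.
- by rewrite -ge0_fin_numE ?measure_ge0// lebesgue_measure_eball_fin.
- exact: measurable_funS mu_.
- by apply: (@bounded_le _ _ C) => y /xX; exact: uC.
Qed.

(** If the integral over [eball x r] exceeds [c], then by monotone convergence so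
    does the integral over a slightly smaller concentric ball, which is contained
    in [eball y r] for all [y] near [x]. *)
Lemma measurable_fun_ge0_integral_eball D X (f : 'rV[R]_N -> \bar R) r :
  open D -> 0 < r -> (forall x, D x -> eball x r `<=` X) ->
  measurable X -> measurable_fun X f -> (forall x, X x -> (0 <= f x)%E) ->
  (forall x, D x -> (\int[mu]_(y in eball x r) f y)%E \is a fin_num) ->
  measurable_fun D (fun x => fine (\int[mu]_(y in eball x r) f y)%E).
Proof.
move=> oD r0 DX mX mf f0 ffin.
have openP (A : set 'rV[R]_N) : A `<=` A° -> open A by rewrite openE.
apply: lsc_measurable_fun_fine => //; first exact: open_measurable_rV.
move=> c; apply: openP => x [Dx cx].
pose B n := eball x (r - n.+1%:R^-1).
have Br n : B n `<=` eball x r.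
  by apply: eball_shrink; rewrite subrr enorm0 invr_ge0.
have nB : {homo B : n m / (n <= m)%N >-> (n <= m)%O}.
  move=> n m nm; apply/subsetPset => y; rewrite /B/eball/= => /lt_le_trans; apply.
  by rewrite lerB// lef_pV2 ?posrE// ler_nat.
have Bx : \bigcup_n B n = eball x r.
  apply/seteqP; split => [y [n _ /Br]//|y xy].
  have d0 : 0 < r - enorm (y - x) by rewrite subr_gt0.
  have [n _ /(_ n (leqnn n))/= nd] := near_infty_natSinv_lt (PosNum d0).
  by exists n => //; rewrite /B/eball/= ltrBrDr addrC -ltrBrDr.
have := @ge0_nondecreasing_set_cvg_integral _ _ _ B f mu nB.
rewrite Bx => /(_ (fun n => measurable_eball _ _)).
have mfB n : measurable_fun (B n) f.
  by apply: (measurable_funS mX) mf; exact: subset_trans (Br n) (DX _ Dx).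
move=> /(_ mfB (fun n y By => f0 _ (DX _ Dx _ (Br _ _ By)))).
move=> /(_ _ (open_ereal_gt' cx))[n _ /(_ n (leqnn n))/= cBn].
have oDx : open_nbhs x (D `&` eball x n.+1%:R^-1).
  split; first by apply: openI => //; exact: open_eball.
  by split => //; rewrite /eball/= subrr enorm0 invr_gt0.
apply: filterS (open_nbhs_nbhs oDx) => y [Dy xy].
split; first exact: Dy.
apply: (lt_le_trans cBn).
apply: ge0_subset_integral.
- exact: measurable_eball.
- exact: measurable_eball.
- exact: (measurable_funS mX (DX _ Dy)) mf.
- by move=> z /(DX _ Dy); exact: f0.
- by apply: eball_shrink; rewrite enormC ltW.
Qed.

Lemma measurable_fun_measure_eball D r : open D -> 0 < r ->
  measurable_fun D (fun x => fine (mu (eball x r))).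
Proof.
move=> oD r0; have intE x : (\int[mu]_(y in eball x r) 1)%E = mu (eball x r).
  by rewrite integral_cst ?mul1e//; exact: measurable_eball.
under eq_fun do rewrite -intE.
apply: (@measurable_fun_ge0_integral_eball D setT) => // x _.
by rewrite intE lebesgue_measure_eball_fin// ltW.
Qed.

Lemma measurable_fun_integral_eball D X u C r :
  open D -> 0 < r -> (forall x, D x -> eball x r `<=` X) ->
  measurable X -> measurable_fun X u -> (forall x, X x -> `|u x| <= C) ->
  measurable_fun D (fun x => \int[mu]_(y in eball x r) u y).
Proof.
move=> oD r0 DX mX mu_ uC.
have mD : measurable D by exact: open_measurable_rV.
(* Adding the constant C makes the integrand nonnegative. *)
apply: (@eq_measurable_fun _ _ _ _ _
  (fun x => \int[mu]_(y in eball x r) (u y + C) - C * fine (mu (eball x r)))).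
  move=> x; rewrite inE => Dx.
  have mB : measurable (eball x r) by exact: measurable_eball.
  have iu := integrable_eball (ltW r0) mX mu_ uC (DX _ Dx).
  rewrite RintegralD//; first by rewrite Rintegral_cst// addrK.
  by apply: (@integrable_eball X _ `|C|) => //; [exact: ltW|exact: DX].
apply: measurable_funB; last first.
  by apply: measurable_funM => //; exact: measurable_fun_measure_eball.
have muC : measurable_fun X (fun y => u y + C) by exact: measurable_funD.
apply: (@measurable_fun_ge0_integral_eball D X) => //.
- exact: measurableT_comp.
- by move=> x /uC; rewrite lee_fin ler_norml -lerBlDr sub0r => /andP[].
- move=> x Dx; apply: integrable_fin_num; first exact: measurable_eball.
  apply: (@integrable_eball X _ (C + `|C|)) => //; [exact: ltW| |exact: DX].
  by move=> y /uC uy; rewrite (le_trans (ler_normD _ _))// lerD2r.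
Qed.

End measurability.

(** * Truncation, and the geometry of the domain *)

Section clamp.
Context {R : realType}.
Implicit Types a b s t C : R.

Definition clamp a b t : R := Num.max a (Num.min b t).

Lemma clamp_le a b s t M : 0 <= M -> s <= t + M -> clamp a b s <= clamp a b t + M.
Proof.
move=> M0 st; rewrite /clamp /Num.max /Num.min.
by do 2![case: (ltP b _) => ?]; do 2?[case: (ltP a _) => ?]; lra.
Qed.

Lemma clamp_bounded a b t C : `|a| <= C -> `|b| <= C -> `|clamp a b t| <= C.
Proof.
rewrite /clamp !ler_norml /Num.max /Num.min => /andP[a1 a2] /andP[b1 b2].
by case: (ltP b _) => ?; case: (ltP a _) => ?; apply/andP; split; lra.
Qed.

End clamp.

Section geometry.
Context {R : realType} {N : nat} (Omega : set 'rV[R]_N) (eps0 : R).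

Lemma eball_sub_Xdom x r : Omega x -> r <= eps0 ->
  eball x r `<=` Xdom Omega eps0.
Proof.
move=> Ox re y xy; have [Oy|nOy] := pselect (Omega y); [by right|left].
split => //; apply: (le_lt_trans _ (lt_le_trans xy re)).
apply: ge_inf; last by exists x.
by exists 0 => _ [z _ <-]; exact: enorm_ge0.
Qed.

Lemma Xdom_bigcup : Omega !=set0 -> 0 < eps0 ->
  Xdom Omega eps0 = \bigcup_(x in Omega) eball x eps0.
Proof.
move=> [x0 Ox0] e0; apply/seteqP; split => [y [[_ dy]|Oy]|y [x Ox]].
- have [|_ [x Ox <-] xy] := inf_lt _ dy; first by exists (enorm (y - x0)), x0.
  by exists x.
- by exists y => //; rewrite /eball/= subrr enorm0.
- exact: eball_sub_Xdom.
Qed.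

Lemma measurable_Xdom : Omega !=set0 -> 0 < eps0 ->
  measurable (Xdom Omega eps0).
Proof.
move=> O0 e0; rewrite Xdom_bigcup//; apply: open_measurable_rV.
by apply: bigcup_open => x _; exact: open_eball.
Qed.

Lemma measurable_Gamma : open Omega -> Omega !=set0 -> 0 < eps0 ->
  measurable (Gamma Omega eps0).
Proof.
move=> oO O0 e0.
rewrite (_ : Gamma Omega eps0 = Xdom Omega eps0 `\` Omega); last first.
  by apply/seteqP; split => y; [move=> Gy; split; [left|case: Gy]|case=> -[]].
by apply: measurableD; [exact: measurable_Xdom|exact: open_measurable_rV].
Qed.

End geometry.

(** * The averaging operator *)

Section tug_mean.
Context {R : realType} {N : nat}.
Variables (X : set 'rV[R]_N) (alpha beta eps : R).
Hypotheses (mX : measurable X) (a0 : 0 <= alpha) (b0 : 0 <= beta)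
  (ab1 : alpha + beta = 1) (eps_gt0 : 0 < eps).
Implicit Types u v : 'rV[R]_N -> R.
Local Notation mu := (@lebesgue_measure_rV R N).

Definition tug_mean u x : R :=
  alpha / 2 * sup (u @` eball x eps) +
  alpha / 2 * inf (u @` eball x eps) +
  beta / fine (mu (eball x eps)) * \int[mu]_(y in eball x eps) u y.

Definition bounded_borel (C : R) u :=
  measurable_fun X u /\ forall x, X x -> `|u x| <= C.

Lemma bounded_borel_ub C u x : bounded_borel C u -> eball x eps `<=` X ->
  has_ubound (u @` eball x eps).
Proof.
move=> [_ uC] xX; exists C => _ [y /xX/uC + <-].
by rewrite ler_norml => /andP[].
Qed.

Lemma bounded_borel_lb C u x : bounded_borel C u -> eball x eps `<=` X ->
  has_lbound (u @` eball x eps).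
Proof.
move=> [_ uC] xX; exists (- C) => _ [y /xX/uC + <-].
by rewrite ler_norml => /andP[].
Qed.

Lemma image_eball_neq0 u x : u @` eball x eps !=set0.
Proof. by exists (u x), x => //; rewrite /eball/= subrr enorm0. Qed.

Lemma measurable_tug_mean D C u : open D -> bounded_borel C u ->
  (forall x, D x -> eball x eps `<=` X) -> measurable_fun D (tug_mean u).
Proof.
move=> oD bu DX; have [mu_ uC] := bu.
have mD : measurable D by exact: open_measurable_rV.
apply: measurable_funD; first apply: measurable_funD.
- apply: measurable_funM => //; apply: measurable_fun_sup_eball => // x /DX.
  exact: bounded_borel_ub bu.
- apply: measurable_funM => //; apply: measurable_fun_inf_eball => // x /DX.
  exact: bounded_borel_lb bu.
- apply: measurable_funM; last exact: (measurable_fun_integral_eball _ _ _ mX mu_ uC).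
  apply: measurable_funM => //.
  (* The inverse of a positive real is its power of exponent -1. *)
  rewrite (_ : (fun x => _) =
      (@powR R ^~ (-1)) \o (fun x => fine (mu (eball x eps)))); last first.
    by apply/funext => x /=; rewrite powR_inv1// ltW// lebesgue_measure_eball_gt0.
  apply: measurableT_comp; first exact: measurable_powR.
  exact: measurable_fun_measure_eball.
Qed.

Lemma sup_image_le (E : set 'rV[R]_N) u v M : E !=set0 ->
  has_ubound (v @` E) -> (forall y, E y -> u y <= v y + M) ->
  sup (u @` E) <= sup (v @` E) + M.
Proof.
move=> [e Ee] vE uv; apply: ge_sup; first by exists (u e), e.
move=> _ [y Ey <-]; apply: (le_trans (uv _ Ey)); rewrite lerD2r.
by apply: ub_le_sup => //; exists y.
Qed.

Lemma inf_image_le (E : set 'rV[R]_N) u v M : E !=set0 ->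
  has_lbound (u @` E) -> (forall y, E y -> u y <= v y + M) ->
  inf (u @` E) <= inf (v @` E) + M.
Proof.
move=> [e Ee] uE uv; rewrite -lerBlDr; apply: lb_le_inf; first by exists (v e), e.
move=> _ [y Ey <-]; rewrite lerBlDr; apply: le_trans (uv _ Ey).
by apply: ge_inf => //; exists y.
Qed.

(** With [t = 0] this is monotonicity together with invariance under adding
    constants. A gain of [t * M] on the cube [corner_box x eps] reaches the value
    at [x] through the mean alone, so it is multiplied by [beta] and by the
    proportion of the ball that the cube occupies. *)
Lemma tug_mean_le C u v x M t : bounded_borel C u -> bounded_borel C v ->
  eball x eps `<=` X -> 0 <= M -> 0 <= t ->
  (forall y, X y -> u y <= v y + M) ->
  (forall y, corner_box x eps y -> u y <= v y + (1 - t) * M) ->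
  tug_mean u x <= tug_mean v x + (1 - beta * box_ratio R N * t) * M.
Proof.
move=> bu bv xX M0 t0 uv uvc; have [mu_ uC] := bu; have [mv vC] := bv.
have xuv y : eball x eps y -> u y <= v y + M by move=> /xX; exact: uv.
have B0 : eball x eps !=set0 by exists x; rewrite /eball/= subrr enorm0.
have hs := sup_image_le B0 (bounded_borel_ub bv xX) xuv.
have hi := inf_image_le B0 (bounded_borel_lb bu xX) xuv.
have mB : measurable (eball x eps) by exact: measurable_eball.
have mc : measurable (corner_box x eps) by exact: measurable_box.
have muB := lebesgue_measure_eball_gt0 x eps_gt0.
have iu := integrable_eball (ltW eps_gt0) mX mu_ uC xX.
have iv := integrable_eball (ltW eps_gt0) mX mv vC xX.
have i1 : mu.-integrable (eball x eps) (EFin \o cst M).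
  by apply: (@integrable_eball _ _ X _ `|M|) => //; exact: ltW.
have i2 : mu.-integrable (eball x eps)
    (EFin \o (fun y => t * M * \1_(corner_box x eps) y)).
  apply: (@integrable_eball _ _ X _ (t * M)) => //; first exact: ltW.
    by apply: measurable_funM => //; exact: measurable_indic.
  move=> y _; rewrite ger0_norm ?mulr_ge0// indicE.
  by case: (_ \in _); rewrite ?mulr1// mulr0 mulr_ge0.
have i3 : mu.-integrable (eball x eps)
    (EFin \o (fun y => M - t * M * \1_(corner_box x eps) y)).
  exact: (integrableB mB i1 i2).
have i4 : mu.-integrable (eball x eps)
    (EFin \o (fun y => v y + (M - t * M * \1_(corner_box x eps) y))).
  exact: (integrableD mB iv i3).
have intc : \int[mu]_(y in eball x eps) \1_(corner_box x eps) y =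
    fine (mu (corner_box x eps)).
  by rewrite /Rintegral integral_indic// setIidl//; exact: corner_box_sub_eball.
(* On the ball, u is at most v + M, and better by t * M on the cube. *)
have hI : \int[mu]_(y in eball x eps) u y <= \int[mu]_(y in eball x eps) v y +
    (M * fine (mu (eball x eps)) - t * M * fine (mu (corner_box x eps))).
  have <- : \int[mu]_(y in eball x eps)
      (v y + (M - t * M * \1_(corner_box x eps) y)) =
      \int[mu]_(y in eball x eps) v y +
      (M * fine (mu (eball x eps)) - t * M * fine (mu (corner_box x eps))).
    rewrite RintegralD// RintegralB// Rintegral_cst// RintegralZl ?intc//.
    apply: (@integrable_eball _ _ X _ 1) => //; first exact: ltW.
    by move=> y _; rewrite ger0_norm// indicE lern1 leq_b1.
  apply: le_Rintegral => // y xy; rewrite indicE.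
  have [/set_mem cy|_] := boolP (y \in corner_box x eps).
    by rewrite mulr1 -[X in X - _]mul1r -mulrBl; exact: uvc.
  by rewrite mulr0 subr0; exact: xuv.
have hr := box_ratioP x eps_gt0.
rewrite /tug_mean.
set B := fine (mu (eball x eps)) in muB hI hr *.
set IU := Rintegral _ _ u in hI *; set IV := Rintegral _ _ v in hI *.
have hI' : IU <= IV + (1 - t * box_ratio R N) * M * B.
  apply: (le_trans hI); rewrite lerD2l.
  have := ler_wpM2l (mulr_ge0 t0 M0) hr; lra.
have hB : beta / B * IU <= beta / B * IV + beta * (1 - t * box_ratio R N) * M.
  have := ler_wpM2l (divr_ge0 b0 (ltW muB)) hI'.
  rewrite mulrDr (_ : beta / B * (_ * B) = beta * (1 - t * box_ratio R N) * M)//.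
  by field; rewrite gt_eqF.
have ha := ler_wpM2l (divr_ge0 a0 (ler0n R 2)) (lerD hs hi).
have hM : (1 - beta * box_ratio R N * t) * M =
    alpha * M + beta * (1 - t * box_ratio R N) * M.
  by rewrite -[X in (X - _)]ab1; ring.
by rewrite hM; lra.
Qed.

End tug_mean.

(** * Maps with a contracting power *)

Section eventual_contraction.
Context {R : realType}.

Lemma geometric_cvg0 (q D : R) : 0 <= q < 1 -> (q ^+ n * D) @[n --> \oo] --> 0.
Proof.
move=> /andP[q0 q1]; have := @cvg_geometric _ D q.
rewrite ger0_norm// => /(_ q1); rewrite /geometric/=.
by under eq_fun do rewrite mulrC.
Qed.

Lemma geometric_le0 (a q D : R) : 0 <= q < 1 ->
  (forall n, a <= q ^+ n * D) -> a <= 0.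
Proof.
by move=> q01 aq; apply: cvgr_to_ge (geometric_cvg0 D q01) _; exact: nearW.
Qed.

(** Banach's theorem, for the sup distance on [X], of a nonexpansive map [T] whose
    [K]-th iterate is a contraction. The functions are total and compared on [X]
    only, so [P] is required to be closed under limits that are pointwise on [X]
    and equality with the fixed point is asserted on [X]. *)
Lemma eventual_contraction_fixpoint (A : Type) (X : set A) (P : set (A -> R))
    (T : (A -> R) -> (A -> R)) (K : nat) (q C : R) (u0 : A -> R) :
  0 <= q < 1 -> 0 <= C -> P u0 -> (forall u, P u -> P (T u)) ->
  (forall u, P u -> forall x, X x -> `|u x| <= C) ->
  (forall (w : nat -> A -> R) u, (forall n, P (w n)) ->
    (forall x, X x -> w n x @[n --> \oo] --> u x) -> P u) ->
  (forall u v M, P u -> P v -> 0 <= M -> (forall x, X x -> `|u x - v x| <= M) ->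
    forall x, X x -> `|T u x - T v x| <= M) ->
  (forall u v M, P u -> P v -> 0 <= M -> (forall x, X x -> `|u x - v x| <= M) ->
    forall x, X x -> `|iter K T u x - iter K T v x| <= q * M) ->
  exists u, [/\ P u, forall x, X x -> T u x = u x &
    forall v, P v -> (forall x, X x -> T v x = v x) ->
      forall x, X x -> v x = u x].
Proof.
move=> q01 C0 Pu0 PT PC Pcl T1 TK.
have q0 : 0 <= q by case/andP: q01.
have Piter n u : P u -> P (iter n T u).
  by move=> Pu; elim: n => //= n; exact: PT.
have rate n u v : P u -> P v -> forall x, X x ->
    `|iter (n * K) T u x - iter (n * K) T v x| <= q ^+ n * (C + C).
  move=> Pu Pv; elim: n => [|n IH] x Xx.
    rewrite mul0n expr0 mul1r (le_trans (ler_normB _ _))// lerD//; exact: PC.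
  rewrite mulSn !iterD exprS -mulrA.
  apply: TK => //; [exact: Piter|exact: Piter|].
  by rewrite mulr_ge0 ?exprn_ge0 ?addr_ge0.
pose w n := iter (n * K) T u0.
have wC n m x : X x -> (n <= m)%N -> `|w n x - w m x| <= q ^+ n * (C + C).
  move=> Xx nm; rewrite /w -(subnKC nm) mulnDl iterD.
  by apply: rate => //; exact: Piter.
have wcvg x : X x -> cvgn (fun n => w n x).
  move=> Xx; apply/cauchy_cvgP/cauchy_exP => e e0.
  have /cvgr_lt/(_ _ e0)[n _ /(_ n (leqnn n))/= ne] := geometric_cvg0 (C + C) q01.
  exists (w n x); exists n => // m /= nm; rewrite /ball/=.
  exact: le_lt_trans (wC _ _ _ Xx nm) ne.
pose u x := limn (fun n => w n x).
have wu n x : X x -> `|w n x - u x| <= q ^+ n * (C + C).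
  move=> Xx.
  have : `|w n x - w m x| @[m --> \oo] --> `|w n x - u x|.
    by apply: cvg_norm; apply: cvgB; [exact: cvg_cst|exact: wcvg].
  by move=> /cvgr_to_le; apply; exists n => // m /= nm; exact: wC.
have Pw n : P (w n) by exact: Piter.
have Pu : P u by apply: (Pcl w) => // x; exact: wcvg.
have qC n : 0 <= q ^+ n * (C + C) by rewrite mulr_ge0 ?exprn_ge0 ?addr_ge0.
have Tu x : X x -> T u x = u x.
  move=> Xx; apply/eqP; rewrite -subr_eq0 -normr_le0.
  apply: (@geometric_le0 _ q ((C + C) * 3)) => // n.
  have h1 := T1 _ _ _ Pu (Pw n) (qC n) _ x Xx.
  have h2 := rate n (T u0) u0 (PT _ Pu0) Pu0 x Xx.
  have h3 := wu n x Xx.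
  rewrite -iterSr -/(w n) iterS -/(w n) in h2.
  have {}h1 : `|T u x - T (w n) x| <= q ^+ n * (C + C).
    by apply: h1 => y Xy; rewrite distrC; exact: wu.
  have h4 := ler_distD (T (w n) x) (T u x) (u x).
  have h5 := ler_distD (w n x) (T (w n) x) (u x).
  by rewrite mulrA; lra.
exists u; split => // v Pv Tv x Xx.
(* T f agrees with f on X only, so iterating uses that T respects equality on X,
   which is nonexpansiveness with M = 0. *)
have fixK f k : P f -> (forall y, X y -> T f y = f y) ->
    forall y, X y -> iter k T f y = f y.
  move=> Pf Tf; elim: k => //= k IH y Xy.
  rewrite -[RHS]Tf//; apply/eqP; rewrite -subr_eq0 -normr_le0.
  by apply: T1 => //; [exact: Piter|move=> z Xz; rewrite IH// subrr normr0].
apply/eqP; rewrite -subr_eq0 -normr_le0.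
apply: (@geometric_le0 _ q (C + C)) => // n.
by have := rate n v u Pv Pu x Xx; rewrite !fixK.
Qed.

End eventual_contraction.

(** * The obstacle operator *)

Section obstacle_operator.
Context {R : realType} {N : nat}.
Variables (Omega : set 'rV[R]_N) (eps0 alpha beta : R).
Variables (Psi1 Psi2 F : 'rV[R]_N -> R) (eps C : R).
Local Notation X := (Xdom Omega eps0).
Local Notation G := (Gamma Omega eps0).
Hypotheses (oO : open Omega) (O0 : Omega !=set0) (eps_gt0 : 0 < eps)
  (eps_eps0 : eps < eps0).
Hypotheses (a0 : 0 <= alpha) (b0 : 0 < beta) (ab1 : alpha + beta = 1).
Hypotheses (mPsi1 : measurable_fun setT Psi1)
  (mPsi2 : measurable_fun setT Psi2) (mF : measurable_fun G F).
Hypotheses (Psi1C : forall x, `|Psi1 x| <= C)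
  (Psi2C : forall x, `|Psi2 x| <= C) (FC : forall x, G x -> `|F x| <= C).
Implicit Types u v : 'rV[R]_N -> R.

Definition obstacle_op u : 'rV[R]_N -> R := fun x =>
  if `[< Omega x >] then clamp (Psi1 x) (Psi2 x) (tug_mean alpha beta eps u x)
  else F x.
Local Notation T := obstacle_op.

(** The complete set on which Banach's argument runs. *)
Definition admissible u := bounded_borel X C u /\ forall x, G x -> u x = F x.

Let eps0_gt0 : 0 < eps0. Proof. exact: lt_trans eps_eps0. Qed.
Let mX : measurable X. Proof. exact: measurable_Xdom. Qed.
Let mG : measurable G. Proof. exact: measurable_Gamma. Qed.
Let mO : measurable Omega. Proof. exact: open_measurable_rV. Qed.
Let OX x : Omega x -> eball x eps `<=` X.
Proof. by move=> Ox; apply: eball_sub_Xdom => //; exact: ltW. Qed.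

Lemma obstacle_op_Omega u x : Omega x ->
  T u x = clamp (Psi1 x) (Psi2 x) (tug_mean alpha beta eps u x).
Proof. by move=> Ox; rewrite /T asboolT. Qed.

Lemma obstacle_op_Gamma u x : G x -> T u x = F x.
Proof. by move=> [nOx _]; rewrite /T asboolF. Qed.

(** The bound [C] on [T u] comes from the obstacles and from [F], whatever the
    bound [C'] on [u]. *)
Lemma obstacle_op_admissible C' u : bounded_borel X C' u -> admissible (T u).
Proof.
move=> bu; split; last exact: obstacle_op_Gamma.
split; last first.
  move=> x [Gx|Ox]; first by rewrite obstacle_op_Gamma// FC.
  by rewrite obstacle_op_Omega// clamp_bounded.
apply/measurable_funU => //; split.
  by apply: eq_measurable_fun mF => x /set_mem Gx; rewrite obstacle_op_Gamma.
apply: (@eq_measurable_fun _ _ _ _ _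
  (fun x => clamp (Psi1 x) (Psi2 x) (tug_mean alpha beta eps u x))).
  by move=> x /set_mem Ox; rewrite obstacle_op_Omega.
apply: measurable_maxr; first exact: measurable_funTS.
apply: measurable_minr; first exact: measurable_funTS.
by apply: measurable_tug_mean bu OX.
Qed.

Let rho : R := beta * box_ratio R N.

Let rho_gt0 : 0 < rho. Proof. by rewrite mulr_gt0// box_ratio_gt0. Qed.

Let rho_le1 : rho <= 1.
Proof.
have b1 : beta <= 1 by rewrite -ab1 lerDr.
apply: mulr_ile1 => //; [exact: ltW| |exact: box_ratio_le1].
exact/ltW/box_ratio_gt0.
Qed.

Lemma obstacle_op_dist u v x M t : admissible u -> admissible v -> Omega x ->
  0 <= M -> 0 <= t <= 1 ->
  (forall y, X y -> `|u y - v y| <= M) ->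
  (forall y, corner_box x eps y -> `|u y - v y| <= (1 - t) * M) ->
  `|T u x - T v x| <= (1 - rho * t) * M.
Proof.
move=> [bu _] [bv _] Ox M0 /andP[t0 t1] uv uvc.
have k0 : 0 <= (1 - rho * t) * M.
  by rewrite mulr_ge0// subr_ge0 mulr_ile1// ltW.
rewrite !obstacle_op_Omega// ler_distlC.
apply/andP; split.
  rewrite lerBlDr; apply: clamp_le => //.
  apply: (tug_mean_le mX a0 (ltW b0) ab1 eps_gt0 bu bv (OX Ox)) => // y.
  - by move=> /uv; rewrite ler_distl => /andP[]; lra.
  - by move=> /uvc; rewrite ler_distl => /andP[]; lra.
apply: clamp_le => //.
apply: (tug_mean_le mX a0 (ltW b0) ab1 eps_gt0 bv bu (OX Ox)) => // y.
- by move=> /uv; rewrite ler_distl => /andP[]; lra.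
- by move=> /uvc; rewrite ler_distl => /andP[]; lra.
Qed.

Lemma obstacle_op_nonexpansive u v M : admissible u -> admissible v -> 0 <= M ->
  (forall y, X y -> `|u y - v y| <= M) ->
  forall x, X x -> `|T u x - T v x| <= M.
Proof.
move=> au av M0 uv x [Gx|Ox].
  by rewrite !obstacle_op_Gamma// subrr normr0.
rewrite -[leRHS]mul1r -[X in X * _]subr0 -(mulr0 rho).
apply: obstacle_op_dist => //; first by rewrite lexx ler01.
move=> y /(corner_box_sub_eball eps_gt0)/(OX Ox)/uv.
by rewrite subr0 mul1r.
Qed.

Let iter_admissible k u : admissible u -> admissible (iter k T u).
Proof.
by move=> au; elim: k => //= k [bu _]; exact: obstacle_op_admissible bu.
Qed.

(** Induction on [k]. Points of X with [b < x 0 i] are in Gamma, where the iterates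
    agree. The cube [corner_box x eps] lies in the [k]-th half-space as soon as [x] is in
    the next one, since its points are at least one step [eps / N.+1 / 2] to the
    right of [x]. *)
Lemma obstacle_op_iter_halfspace (i : 'I_N) b k u v M :
  (forall x, Omega x -> x 0 i <= b) ->
  admissible u -> admissible v -> 0 <= M ->
  (forall y, X y -> `|u y - v y| <= M) ->
  forall x, X x -> b - k%:R * (eps / N.+1%:R / 2) < x 0 i ->
  `|iter k T u x - iter k T v x| <= (1 - rho ^+ k) * M.
Proof.
move=> Ob au av M0 uv; set s := eps / _ / 2.
have rk j : 0 <= rho ^+ j <= 1.
  by rewrite exprn_ge0 ?exprn_ile1 ?(ltW rho_gt0).
have uvk j y : X y -> `|iter j T u y - iter j T v y| <= M.
  elim: j y => [|j IH] y Xy; first exact: uv.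
  by apply: obstacle_op_nonexpansive => //; exact: iter_admissible.
have GM j x : G x -> `|iter j T u x - iter j T v x| <= (1 - rho ^+ j) * M.
  move=> Gx; have [_ ->//] := iter_admissible j au.
  have [_ ->//] := iter_admissible j av.
  rewrite subrr normr0 mulr_ge0// subr_ge0.
  by case/andP: (rk j).
elim: k => [|k IH] x [Gx|Ox] bx; [exact: GM|..|exact: GM|].
  by move: bx; rewrite mul0r subr0 ltNge Ob.
rewrite exprS; apply: obstacle_op_dist => //; [exact: iter_admissible|
  exact: iter_admissible|exact: uvk|].
move=> y xy; apply: IH; first exact: (OX Ox (corner_box_sub_eball eps_gt0 xy)).
move: bx; rewrite -natr1 mulrDl mul1r => bx.
by have /andP[yi _] := xy i; rewrite -/s in yi; lra.
Qed.

Lemma obstacle_op_iter_contraction : (0 < N)%N -> bounded_set Omega ->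
  exists K q, 0 <= q < 1 /\ forall u v M,
    admissible u -> admissible v -> 0 <= M ->
    (forall y, X y -> `|u y - v y| <= M) ->
    forall x, X x -> `|iter K T u x - iter K T v x| <= q * M.
Proof.
move=> N0 /pinfty_ex_gt0[b _ Ob].
pose i := Ordinal N0.
have {}Ob x : Omega x -> `|x 0 i| <= b.
  move=> /Ob; apply: le_trans.
  rewrite [leRHS]mx_normE -[leLHS]nngE num_le.
  exact: (le_bigmax _ (fun j => `|x j.1 j.2|%:nng) (0, i)).
set s := eps / N.+1%:R / 2.
have s0 : 0 < s by rewrite !divr_gt0.
(* Omega lies between -b and b, and K steps of length s cross this interval. *)
pose K := (Num.truncn (2 * b / s)).+1.
have Ks : 2 * b < K%:R * s by rewrite -ltr_pdivrMr// truncnS_gt.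
exists K, (1 - rho ^+ K).
have rK : 0 < rho ^+ K <= 1 by rewrite exprn_gt0 ?exprn_ile1 ?(ltW rho_gt0).
split; first lra.
move=> u v M au av M0 uv x [Gx|Ox].
  have [_ ->//] := iter_admissible K au.
  have [_ ->//] := iter_admissible K av.
  by rewrite subrr normr0 mulr_ge0//; lra.
apply: (@obstacle_op_iter_halfspace i b) => //; [|by right|].
  by move=> y /Ob; rewrite ler_norml => /andP[].
by have := Ob _ Ox; rewrite ler_norml -/s => /andP[]; lra.
Qed.

Lemma admissible_lim (w : nat -> 'rV[R]_N -> R) u : (forall n, admissible (w n)) ->
  (forall x, X x -> w n x @[n --> \oo] --> u x) -> admissible u.
Proof.
move=> aw wu; split; last first.
  move=> x Gx; have := wu x (or_introl Gx).
  rewrite (_ : (fun n => w n x) = cst (F x)); last first.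
    by apply/funext => n; case: (aw n) => _ ->.
  by move=> /(cvg_lim (@Rhausdorff R)) <-; rewrite lim_cst.
split; first by apply: measurable_fun_cvg wu => n; case: (aw n) => -[].
move=> x Xx; have /cvg_norm/cvgr_to_le := wu x Xx; apply.
by apply: nearW => n; case: (aw n) => -[_ wC] _; exact: wC.
Qed.

(** A solution is automatically bounded on X, being truncated between the
    obstacles in Omega and equal to [F] on Gamma. *)
Lemma borel_solutionP u :
  borel_solution Omega eps0 alpha beta Psi1 Psi2 F eps u <->
  admissible u /\ forall x, X x -> T u x = u x.
Proof.
split=> [[mu_ uO uG]|[[[mu_ _] uG] Tu]].
  have Tu x : X x -> T u x = u x.
    move=> [Gx|Ox]; first by rewrite obstacle_op_Gamma// uG.
    by rewrite obstacle_op_Omega// uO.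
  split=> //; split=> //; split=> // x Xx; rewrite -Tu//.
  case: Xx => [Gx|Ox]; first by rewrite obstacle_op_Gamma// FC.
  by rewrite obstacle_op_Omega// clamp_bounded.
split=> // x Ox; rewrite -Tu; last by right.
by rewrite obstacle_op_Omega.
Qed.

End obstacle_operator.

(** * Existence and uniqueness *)

Theorem theorem1p2 (R : realType) (N : nat) (Omega : set 'rV[R]_N)
    (eps0 alpha beta : R) (Psi1 Psi2 F : 'rV[R]_N -> R) :
  (0 < N)%N ->
  domain Omega -> bounded_set Omega -> lipschitz_boundary Omega ->
  0 < eps0 < 1 ->
  0 <= alpha < 1 -> beta = 1 - alpha ->
  measurable_fun setT Psi1 -> [bounded Psi1 x | x in setT] ->
  measurable_fun setT Psi2 -> [bounded Psi2 x | x in setT] ->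
  measurable_fun (Gamma Omega eps0) F ->
  [bounded F x | x in Gamma Omega eps0] ->
  (forall x, Xdom Omega eps0 x -> Psi1 x <= Psi2 x) ->
  (forall x, Gamma Omega eps0 x -> Psi1 x <= F x <= Psi2 x) ->
  forall eps : R, 0 < eps < eps0 ->
  exists u : 'rV[R]_N -> R,
    borel_solution Omega eps0 alpha beta Psi1 Psi2 F eps u /\
    forall v : 'rV[R]_N -> R,
      borel_solution Omega eps0 alpha beta Psi1 Psi2 F eps v ->
      {in Xdom Omega eps0, v =1 u}.
Proof.
move=> N0 [neO oO _] bO _ _ /andP[a0 a1] betaE.
move=> mP1 /pinfty_ex_gt0[C1 _ P1C] mP2 /pinfty_ex_gt0[C2 _ P2C].
move=> mF /pinfty_ex_gt0[C3 _ FC] _ _ eps /andP[eps_gt0 eps_lt].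
have b0 : 0 < beta by rewrite betaE subr_gt0.
have ab1 : alpha + beta = 1 by rewrite betaE addrC subrK.
pose C := Num.max 0 (Num.max C1 (Num.max C2 C3)).
have C0 : 0 <= C by rewrite le_max lexx.
have {}P1C x : `|Psi1 x| <= C.
  by rewrite /C !le_max (P1C _ I) !orbT.
have {}P2C x : `|Psi2 x| <= C.
  by rewrite /C !le_max (P2C _ I) !orbT.
have {}FC x : Gamma Omega eps0 x -> `|F x| <= C.
  by move=> /FC xC; rewrite /C !le_max xC !orbT.
pose T := obstacle_op Omega alpha beta Psi1 Psi2 F eps.
pose P := admissible Omega eps0 F C.
have PT C' u : bounded_borel (Xdom Omega eps0) C' u -> P (T u).
  by move=> bu; apply: obstacle_op_admissible bu.
have T1 : forall u v M, P u -> P v -> 0 <= M ->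
    (forall x, Xdom Omega eps0 x -> `|u x - v x| <= M) ->
    forall x, Xdom Omega eps0 x -> `|T u x - T v x| <= M.
  exact: (obstacle_op_nonexpansive Psi1 Psi2 neO eps_gt0 eps_lt a0 b0 ab1).
have [K [q [q01 TK]]] : exists K q, 0 <= q < 1 /\ forall u v M,
    P u -> P v -> 0 <= M ->
    (forall x, Xdom Omega eps0 x -> `|u x - v x| <= M) ->
    forall x, Xdom Omega eps0 x -> `|iter K T u x - iter K T v x| <= q * M.
  by apply: obstacle_op_iter_contraction.
have P0 : P (T (cst 0)).
  by apply: (PT 0); split => [|x _]; [exact: measurable_cst|rewrite normr0].
have [u [Pu Tu uniq]] := @eventual_contraction_fixpoint R _ (Xdom Omega eps0)
  P T K q C (T (cst 0)) q01 C0 P0 (fun u Pu => PT C u Pu.1) (fun u Pu => Pu.1.2)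
  (fun w u => @admissible_lim _ _ _ _ _ _ w u) T1 TK.
have solP v : borel_solution Omega eps0 alpha beta Psi1 Psi2 F eps v <->
    P v /\ forall x, Xdom Omega eps0 x -> T v x = v x.
  exact: borel_solutionP.
exists u; split; first by apply/solP.
by move=> v /solP[Pv Tv] x /set_mem Xx; exact: uniq.
Qed.
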